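(* If $F$ is a graph with $\ell$ vertices, then $W^*_\kappa[F]>\tfrac13\,\ell-\tfrac43\log_2\ell$.
   Context: Graphs are finite, simple, undirected, loopless. First-order sentences about graphs use only adjacency $\sim$ and equality $=$. Write $F\sqsubset G$ if $G$ contains an induced copy of $F$. For non-isomorphic $G,H$, $W(G,H)$ is the minimum number of distinct variables in a first-order sentence true on one and false on the other. $W^*_\kappa[F]=\min_s\max\{W(G,H): F\sqsubset G,\ F\not\sqsubset H,\ G\text{ and }H\text{ both }s\text{-connected}\}$. *)

(* Defs.v *)
From mathcomp Require Import all_boot all_order all_algebra.
From mathcomp Require Import classical_sets reals exp.

Set Implicit Arguments.
Unset Strict Implicit.
Unset Printing Implicit Defensive.

Local Open Scope classical_set_scope.

Record sgraph := SGraph {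
  vertex :> finType;
  adj : rel vertex;
  adj_sym : symmetric adj;
  adj_irr : irreflexive adj }.

Definition induced_sub (F G : sgraph) : Prop :=
  exists2 f : F -> G, injective f & forall x y, adj (f x) (f y) = adj x y.

(* [s < #|G|] excludes small complete graphs, which no vertex removal can
   disconnect; it also means that an s-connected graph is never empty. *)
Definition s_connected (s : nat) (G : sgraph) : Prop :=
  s < #|G| /\
  forall S : {set G}, #|S| < s -> forall x y : G, x \notin S -> y \notin S ->
    connect [rel u v | [&& u \notin S, v \notin S & adj u v]] x y.

(* The remaining connectives and the universal quantifier are the usual
   abbreviations; they introduce no further variables. *)
Inductive formula : Type :=
| FEq of nat & nat
| FAdj of nat & nat
| FNot of formula
| FAnd of formula & formula
| FEx of nat & formula.

Fixpoint vars (phi : formula) : seq nat :=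
  match phi with
  | FEq x y | FAdj x y => [:: x; y]
  | FNot p => vars p
  | FAnd p q => vars p ++ vars q
  | FEx x p => x :: vars p
  end.

Fixpoint free_vars (phi : formula) : seq nat :=
  match phi with
  | FEq x y | FAdj x y => [:: x; y]
  | FNot p => free_vars p
  | FAnd p q => free_vars p ++ free_vars q
  | FEx x p => [seq y <- free_vars p | y != x]
  end.

Definition sentence (phi : formula) : bool := nilp (free_vars phi).

(* A variable bound and re-bound several times counts once. *)
Definition num_vars (phi : formula) : nat := size (undup (vars phi)).

(* Assignments are partial so that evaluation needs no default vertex.  The
   value on an unassigned variable is irrelevant for sentences. *)
Fixpoint eval (G : sgraph) (v : nat -> option G) (phi : formula) : bool :=
  match phi with
  | FEq x y => if (v x, v y) is (Some a, Some b) then a == b else false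
  | FAdj x y => if (v x, v y) is (Some a, Some b) then adj a b else false
  | FNot p => ~~ eval v p
  | FAnd p q => eval v p && eval v q
  | FEx x p => [exists a : G, eval (fun z => if z == x then Some a else v z) p]
  end.

Definition holds (G : sgraph) (phi : formula) : bool :=
  eval (fun _ => None : option G) phi.

(* Minimum and maximum of a set of natural numbers, 0 when there is none. *)
Definition nat_min (A : set nat) : nat :=
  xget 0 [set m | A m /\ forall n, A n -> m <= n].

Definition nat_max (A : set nat) : nat :=
  xget 0 [set m | A m /\ forall n, A n -> n <= m].

(* Meaningful only for non-isomorphic G and H; it is 0 otherwise. *)
Definition W (G H : sgraph) : nat :=
  nat_min [set k | exists phi : formula,
    [/\ sentence phi, holds G phi != holds H phi & num_vars phi = k]].

(* The set below is bounded by #|F|: an existential sentence with #|F|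
   variables expresses the presence of an induced copy of F.  If F has at
   least three vertices, the set is non-empty for every s.  It is empty for
   every s if F is K_1, and for every s >= 1 if F is K_2. *)
Definition Wkappa_at (F : sgraph) (s : nat) : nat :=
  nat_max [set k | exists G H : sgraph,
    [/\ induced_sub F G, ~ induced_sub F H,
        s_connected s G, s_connected s H & W G H = k]].

Definition Wkappa (F : sgraph) : nat := nat_min (range (Wkappa_at F)).

Definition log2 (R : realType) (x : R) : R := (ln x / ln 2)%R.

(* Main.v *)
Require Import Defs.
From mathcomp Require Import all_boot all_order all_algebra.
From mathcomp Require Import classical_sets reals exp.
From mathcomp Require Import boolp zify lra.
From mathcomp Require Import fintype finset.

(* Let [l = #|F|].  Two graphs in which every [j] vertices extend in all
   [2 ^ j] ways agree on sentences with [j + 1] variables, and this persists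
   after joining both to the same graph X on [s + 1] vertices, which makes them
   s-connected.  On the side of G, such a graph containing F is obtained by
   planting F into a random graph.  On the side of H there are two cases.

   If F has at least [j + 3] universal vertices, they form a clique.  A random
   [j + 1]-partite graph has the extension property, since [j] vertices always
   miss one part; joined to an independent set X it is [j + 2]-colourable, so it
   does not contain F.

   Otherwise X is a clique: in a copy of F, only universal vertices can lie in
   X, so it suffices to exclude the subgraph of F on its at least [l - j - 2]
   non-universal vertices.  A random graph on about [2 ^ ((l - j) / 2)] vertices
   does so, and it has the extension property as long as this number exceeds
   [2 ^ j] by a factor of order [l ^ 2], that is, when
   [l ^ 4 * 8 ^ j <= 2 ^ l]. *)

Set Implicit Arguments.
Unset Strict Implicit.
Unset Printing Implicit Defensive.

(** * Cardinality and elementary inequalities *)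

Lemma subset_of_card (T : finType) (S : {set T}) (k : nat) :
  k <= #|S| -> exists2 S' : {set T}, S' \subset S & #|S'| = k.
Proof.
move=> kS; exists [set x in take k (enum S)].
  by apply/subsetP=> x; rewrite inE => /mem_take; rewrite mem_enum.
rewrite cardsE; have /card_uniqP -> : uniq (take k (enum S)).
  by rewrite take_uniq ?enum_uniq.
by rewrite size_take_min -cardE; apply/minn_idPl.
Qed.

Lemma superset_of_card (T : finType) (S : {set T}) (k : nat) :
  #|S| <= k <= #|T| -> exists2 S' : {set T}, S \subset S' & #|S'| = k.
Proof.
case/andP=> Sk kT; have := cardsC S => cS.
have [|D DS cD] := @subset_of_card _ (~: S) (k - #|S|); first lia.
exists (S :|: D); first exact: subsetUl.
rewrite cardsU cD (_ : S :&: D = set0) ?cards0; first by lia.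
by apply/eqP; rewrite setI_eq0 disjoint_sym disjoints_subset.
Qed.

(** This is Bernoulli's inequality with denominators cleared, the inner claim [bern] taken at
    exponent [M]. For [M = 2 ^ j] it bounds [(1 - 2 ^- j) ^ (2 ^ j)] by one half. *)
Lemma double_predn_exp (M : nat) : 0 < M -> 2 * M.-1 ^ M <= M ^ M.
Proof.
case: M => // m _ /=; case: m => [|m] //.
suff bern k : m.+1 ^ k * (m.+1 + k) <= m.+2 ^ k * m.+1.
  have := bern m.+2.
  rewrite -(leq_pmul2r (_ : 0 < m.+1)) //.
  by have := expn_gt0 m.+1 m.+2; nia.
elim: k => [|k IHk]; first by rewrite !expn0 addn0.
rewrite !expnS.
rewrite -[leqRHS]mulnA; apply: leq_trans (leq_mul (leqnn m.+2) IHk).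
by rewrite [leqLHS]mulnAC [leqRHS]mulnCA mulnC leq_mul2l; apply/orP; right; nia.
Qed.

Lemma bin_leq_exp (n k : nat) : 'C(n, k) <= n ^ k.
Proof.
rewrite (@leq_trans (n ^_ k)) //.
  by rewrite -bin_ffact leq_pmulr // fact_gt0.
elim: k n => [|k IHk] [|n] //.
rewrite ffactSS expnS leq_mul2l /=; apply: leq_trans (IHk n) _.
by case: k {IHk} => // k; rewrite leq_exp2r.
Qed.

(** * Uniformly random subsets, with probabilities written as cardinalities *)

Section RandomSubsets.
Variable I : finType.
Implicit Types (P Z pi : {set I}) (B : {set {set I}}).

(** Exchanging the trace on [P] for another one, while keeping the rest of the set, is injective and
    stays in [B]; hence all [2 ^ #|P|] traces occur equally often in [B]. *)
Lemma card_fixed_trace P pi B :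
    pi \subset P ->
    (forall g h : {set I}, g :\: P = h :\: P -> (g \in B) = (h \in B)) ->
  2 ^ #|P| * #|[set g in B | g :&: P == pi]| = #|B|.
Proof.
move=> piP invB.
pose tr Z := [set g in B | g :&: P == Z].
have repl Z Z' : Z' \subset P -> #|tr Z| <= #|tr Z'|.
  move=> Z'P; rewrite -(@card_in_imset _ _ (fun g => (g :\: P) :|: Z')).
    apply/subset_leq_card/subsetP=> _ /imsetP[g + ->].
    rewrite !inE => /andP[gB /eqP gZ].
    have dP : (g :\: P :|: Z') :\: P = g :\: P.
      rewrite setDUl setDDl setUid; apply/setUidPl.
      by apply: subset_trans (sub0set _); rewrite subset0 setD_eq0.
    rewrite (invB _ g) // gB /= setIUl (setIidPl Z'P).
    apply/eqP/setP=> x; rewrite !inE.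
    by case: (x \in P); rewrite ?andbF.
  move=> g h; rewrite !inE => /andP[_ /eqP gZ] /andP[_ /eqP hZ] /setP e.
  rewrite -(setID g P) -(setID h P) gZ hZ; congr (_ :|: _).
  apply/setP=> x; have := e x; rewrite !inE.
  by case: (boolP (x \in P)) => //= xP; rewrite (contraNF (subsetP Z'P x) xP) !orbF.
rewrite -card_powerset -sum_nat_const.
rewrite -[#|B|]sum1_card [RHS](partition_big (fun g => g :&: P) (mem (powerset P))) /=.
  apply: eq_bigr => Z ZP; rewrite powersetE in ZP.
  rewrite sum1dep_card -[LHS]/#|tr pi| -[RHS]/#|tr Z|.
  by apply/eqP; rewrite eqn_leq !repl.
by move=> g _; rewrite powersetE subsetIr.
Qed.

(* Disjoint blocks behave as independent events, each of probability [2 ^- j]. *)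
Lemma card_avoid_traces (J : eqType) (S : seq J) (P pi : J -> {set I}) (j : nat) :
    uniq S -> {in S, forall v, #|P v| = j} -> {in S, forall v, pi v \subset P v} ->
    {in S &, forall u v, u != v -> [disjoint P u & P v]} ->
  #|[set g : {set I} | all (fun v => g :&: P v != pi v) S]| * (2 ^ j) ^ size S
    = #|{set I}| * (2 ^ j).-1 ^ size S.
Proof.
elim: S => [|v S IHS] /=.
  by move=> *; rewrite !expn0 !muln1 -cardsT; apply: eq_card => g; rewrite !inE.
move=> /andP[vS uS] cP sP dP.
have inS u : u \in S -> u \in v :: S by rewrite inE orbC => ->.
have {}IHS : _ := IHS uS (fun u h => cP u (inS u h)) (fun u h => sP u (inS u h))
  (fun u w hu hw => dP u w (inS u hu) (inS w hw)).
set B := [set g : {set I} | all _ S] in IHS.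
have vv : v \in v :: S by rewrite inE eqxx.
have /card_fixed_trace : pi v \subset P v by exact: sP.
move=> /(_ B); rewrite cP // => fixB.
have {}fixB : 2 ^ j * #|[set g in B | g :&: P v == pi v]| = #|B|.
  (* The blocks in [S] are disjoint from [P v], so membership in [B] is decided outside [P v]. *)
  apply: fixB => g h /setP e; rewrite !inE; apply: eq_in_all => u uS'.
  suff -> : g :&: P u = h :&: P u by [].
  have uv : u != v by apply: contraNneq vS => <-.
  have /pred0P d := dP u v (inS _ uS') vv uv.
  apply/setP=> x; have := e x; have := d x; rewrite /= !inE.
  by case: (x \in P u) => /= [->|]; rewrite ?andbF ?andbT.
set C := [set g | _].
have -> : C = B :\: [set g in B | g :&: P v == pi v].
  by apply/setP=> g; rewrite !inE; case: (all _ _); rewrite ?andbT ?andbF.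
rewrite cardsD (_ : B :&: _ = [set g in B | g :&: P v == pi v]); last first.
  by apply/setIidPr/subsetP=> g; rewrite inE => /andP[].
rewrite -fixB in IHS *; rewrite !expnS.
move: #|[set g in B | _]| IHS => x; move: (expn_gt0 2 j).
move: (2 ^ j) => [|a] //= _ IHS.
transitivity (a * (a.+1 * x * a.+1 ^ size S)); last by rewrite IHS mulnCA.
by rewrite {1}mulSn addKn -mulnA (mulnCA x) (mulnA a.+1).
Qed.

End RandomSubsets.

(** The union bound, with each probability given as the fraction [d / c] over a common total. *)
Lemma card_bigcup_leq (I T : finType) (P : pred I) (F : I -> {set T}) (c d : nat) :
    (forall i, P i -> #|F i| * c <= d) ->
  #|\bigcup_(i | P i) F i| * c <= #|P| * d.
Proof.
move=> le_d; rewrite (_ : #|P| * d = \sum_(i | P i) d); last first.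
  by rewrite -sum_nat_const; apply: eq_bigl.
apply: (big_rec2 (fun (X : {set T}) n => #|X| * c <= n)).
  by rewrite cards0.
move=> i n X Pi IH; rewrite (leq_trans _ (leq_add (le_d i Pi) IH)) //.
by rewrite -mulnDl leq_mul2r cardsU leq_subr orbT.
Qed.

(** * The extension property and copies of a pattern in random graphs *)

Definition extension (j : nat) (G : sgraph) : Prop :=
  forall A B : {set G}, #|A| <= j ->
  exists2 v, v \notin A & {in A, forall a, adj v a = (a \in B)}.

Lemma pair_inj (T : finType) (v a b : T) :
  v != a -> [set v; a] = [set v; b] -> a = b.
Proof.
move=> va /setP/(_ a); rewrite !inE eqxx orbT eq_sym (negPf va) /=.
by move/esym/eqP.
Qed.

Section RandomGraphs.
Variables (V : finType) (M E0 : rel V).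
Hypotheses (symM : symmetric M) (symE : symmetric E0).
Implicit Types (g : {set {set V}}) (A B S : {set V}).

(** [M] marks the random pairs, which [g] decides; [E0] fixes the others. Probability is counting
    over all [g], where members other than pairs only scale the counts. *)
Definition rand_adj g : rel V :=
  fun x y => (x != y) && (if M x y then [set x; y] \in g else E0 x y).

Lemma rand_adj_sym g : symmetric (rand_adj g).
Proof. by move=> x y; rewrite /rand_adj eq_sym symM symE setUC. Qed.

Lemma rand_adj_irr g : irreflexive (rand_adj g).
Proof. by move=> x; rewrite /rand_adj eqxx. Qed.

Definition rand_graph g := SGraph (rand_adj_sym g) (rand_adj_irr g).

Definition extends g A B : bool :=
  [exists v, (v \notin A) && [forall a in A, rand_adj g v a == (a \in B)]].

Definition has_ext (j : nat) g : bool :=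
  [forall A : {set V}, (#|A| == j) ==> [forall B in powerset A, extends g A B]].

Lemma has_ext_extension j g :
  j <= #|V| -> has_ext j g -> extension j (rand_graph g).
Proof.
move=> jV /forallP extg A B cA.
have [|A' sA cA'] := @superset_of_card _ A j; first by rewrite cA.
have := extg A'; rewrite cA' eqxx /= => /forallP/(_ (B :&: A')).
rewrite powersetE subsetIr /= => /existsP[v /andP[vA' /forallP adjv]].
exists v; first by apply: contra vA'; apply: (subsetP sA).
move=> a aA; have aA' := subsetP sA a aA.
by have := adjv a; rewrite aA' inE aA' andbT /= => /eqP.
Qed.

(** Each candidate in [S] has the prescribed adjacencies to [A] with probability [2 ^- j],
    independently since the blocks of pairs are disjoint. All [2 ^ j * T] candidates fail with
    probability at most [2 ^- T]. *)
Lemma card_not_extends j T A B S :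
    #|A| = j -> B \subset A -> #|S| = 2 ^ j * T -> [disjoint S & A] ->
    {in S & A, forall v a, M v a} ->
  #|[set g | ~~ extends g A B]| * 2 ^ T <= #|{set {set V}}|.
Proof.
move=> cA BA cS dSA MSA.
have vA v : v \in S -> v \notin A by move=> vS; rewrite (disjointFr dSA).
have neq v a : v \in S -> a \in A -> v != a.
  by move=> vS aA; apply: contraNneq (vA v vS) => ->.
pose P v := [set [set v; a] | a in A]; pose pi v := [set [set v; a] | a in B].
have memP v a (X : {set V}) : X \subset A -> v \in S -> a \in A ->
    ([set v; a] \in [set [set v; b] | b in X]) = (a \in X).
  move=> XA vS aA; apply/imsetP/idP => [[b bX e]|aX]; last by exists a.
  by rewrite (pair_inj (neq v a vS aA) e).
have cardP : {in enum S, forall v, #|P v| = j}.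
  move=> v; rewrite mem_enum => vS; rewrite card_in_imset ?cA // => a b aA _.
  exact: pair_inj (neq v a vS aA).
have piP : {in enum S, forall v, pi v \subset P v}.
  by move=> v _; apply: imsetS.
have dP : {in enum S &, forall u v, u != v -> [disjoint P u & P v]}.
  move=> u v; rewrite !mem_enum => uS vS uv.
  apply/pred0P=> e /=; apply/negP=> /andP[/imsetP[a aA ->]].
  case/imsetP=> b bA /setP/(_ u); rewrite !inE eqxx (negPf uv) /=.
  by move/esym/eqP=> ub; move: (vA u uS); rewrite ub bA.
have := card_avoid_traces (enum_uniq _) cardP piP dP.
rewrite -cardE cS; set C := [set g | all _ _] => cC.
have: #|C| * 2 ^ T <= #|{set {set V}}|.
  move: cC (double_predn_exp (expn_gt0 2 j)); rewrite !expnM.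
  move: (2 ^ j) (expn_gt0 2 j) => X; set Y := X.-1 => X0 cC XY.
  have {}XY : 2 ^ T * (Y ^ X) ^ T <= (X ^ X) ^ T.
    by case: (posnP T) => [->|T0]; rewrite ?expn0 // -expnMn leq_exp2r.
  have {XY} := leq_mul (leqnn #|C|) XY; rewrite cC mulnA.
  (* For [j = 0] the factor [Y ^ X] vanishes and cannot be cancelled; then, unless [T = 0], the set
     [C] is empty. *)
  have [Y0|Y0] := posnP (Y ^ X); last by rewrite leq_pmul2r // expn_gt0 Y0.
  case: T cC {cS} => [|T] cC _; first by rewrite expn0 muln1 max_card.
  move: cC; rewrite Y0 exp0n // muln0 => /eqP.
  rewrite muln_eq0 expn_eq0 [X ^ X == 0]expn_eq0 (negPf (lt0n_neq0 X0)) /=.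
  by rewrite orbF => /eqP ->.
apply: leq_trans; rewrite leq_mul2r; apply/orP; right.
apply/subset_leq_card/subsetP=> g; rewrite !inE => /existsPn noext.
apply/allP=> v; rewrite mem_enum => vS; apply/eqP=> trv.
have := noext v; rewrite (vA v vS) /= => /negP[]; apply/forall_inP=> a aA.
have /setP/(_ [set v; a]) := trv; rewrite inE !memP // aA andbT => <-.
by rewrite /rand_adj neq // MSA.
Qed.

(** Union bound over at most [#|V| ^ j] sets [A] and the [2 ^ j] subsets [B] of each. *)
Lemma card_not_has_ext j T :
    (forall A, #|A| = j -> exists S,
       [/\ #|S| = 2 ^ j * T, [disjoint S & A] & {in S & A, forall v a, M v a}]) ->
  #|[set g | ~~ has_ext j g]| * 2 ^ T <= (2 * #|V|) ^ j * #|{set {set V}}|.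
Proof.
move=> cand.
have sub : [set g | ~~ has_ext j g] \subset
    \bigcup_(A : {set V} | #|A| == j) \bigcup_(B in powerset A)
      [set g | ~~ extends g A B].
  apply/subsetP=> g; rewrite inE => /forallPn[A]; rewrite negb_imply.
  case/andP=> cA /forall_inPn[B BA nAB].
  by apply/bigcupP; exists A => //; apply/bigcupP; exists B => //; rewrite inE.
apply: leq_trans (leq_mul (subset_leq_card sub) (leqnn _)) _.
apply: (@leq_trans ('C(#|V|, j) * (2 ^ j * #|{set {set V}}|))).
  rewrite -(card_draws V j) cardsE; apply: card_bigcup_leq => A /eqP cA.
  rewrite -cA -card_powerset; apply: card_bigcup_leq => B.
  rewrite powersetE => BA; have [S [cS dS MS]] := cand A cA.
  exact: card_not_extends cA BA cS dS MS.
by rewrite mulnA leq_mul2r expnMn mulnC leq_mul2l bin_leq_exp !orbT.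
Qed.

Definition contains (F : sgraph) g : bool :=
  [exists f : {ffun F -> V}, injectiveb f &&
     [forall x, forall y, rand_adj g (f x) (f y) == adj x y]].

(** For each of the [#|V| ^ #|F|] maps, being a copy of [F] prescribes the trace of [g] on the
    images of all pairs, an event of probability at most [2 ^- 'C(#|F|, 2)]. *)
Lemma card_contains (F : sgraph) :
    (forall x y, x != y -> M x y) ->
  #|[set g | contains F g]| * 2 ^ 'C(#|F|, 2) <= #|V| ^ #|F| * #|{set {set V}}|.
Proof.
move=> fullM; pose copy (f : {ffun F -> V}) :=
  [set g | injectiveb f && [forall x, forall y, rand_adj g (f x) (f y) == adj x y]].
have sub : [set g | contains F g] \subset \bigcup_f copy f.
  by apply/subsetP=> g; rewrite inE => /existsP[f fg]; apply/bigcupP; exists f; rewrite ?inE.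
apply: leq_trans (leq_mul (subset_leq_card sub) (leqnn _)) _.
rewrite -card_ffun; apply: card_bigcup_leq => f _.
(* Any [g0] realising the copy [f] shows which trace is prescribed. *)
have [->|[g0]] := set_0Vmem (copy f); first by rewrite cards0.
rewrite inE => /andP[/injectiveP injf /forallP g0f].
pose P := (fun e : {set F} => f @: e) @: [set e : {set F} | #|e| == 2].
have cP : #|P| = 'C(#|F|, 2).
  by rewrite card_in_imset ?card_draws // => e e' _ _; apply: imset_inj.
rewrite -cP -cardsT -(@card_fixed_trace _ P (g0 :&: P) setT); first last.
- by move=> *; rewrite !inE.
- exact: subsetIr.
rewrite mulnC leq_mul2l; apply/orP; right.
apply/subset_leq_card/subsetP=> g; rewrite !inE => /andP[_ /forallP gf].
apply/eqP/setP=> p; rewrite !inE.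
case: (boolP (p \in P)) => [|_]; last by rewrite !andbF.
case/imsetP=> e; rewrite inE => /cards2P[x [y [xy ->]]] ->; rewrite !andbT.
rewrite imsetU1 imset_set1.
have fxy : f x != f y by rewrite (inj_eq injf).
have := forallP (gf x) y; have := forallP (g0f x) y.
by rewrite /rand_adj fxy fullM //= => /eqP -> /eqP.
Qed.

End RandomGraphs.

(** * Existence of graphs with the extension property *)

(** With all pairs on [2 ^ q] vertices random, the extension property fails with probability below
    one half and [F] occurs with probability at most one half. *)
Lemma free_extension_graph (F : sgraph) (q j : nat) :
    2 * q + 2 <= #|F| -> (j * q.+1 + 2) * 2 ^ j < 2 ^ q ->
  exists2 H : sgraph, extension j H & ~ induced_sub F H.
Proof.
move=> qF jq; pose V := 'I_(2 ^ q); pose M : rel V := fun _ _ => true.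
pose E0 : rel V := fun _ _ => false.
have symM : symmetric M by [].
have symE : symmetric E0 by [].
have jleq : j <= q.
  by rewrite -(leq_exp2l (m := 2)) //; nia.
(* The predecessor leaves [2 ^ j > j] vertices over, enough to choose the candidates outside [A]. *)
pose T := (2 ^ (q - j)).-1.
have qE : 2 ^ q = 2 ^ j * 2 ^ (q - j) by rewrite -expnD subnKC.
have TE : 2 ^ (q - j) = T.+1 by rewrite prednK // expn_gt0.
have j2 : j < 2 ^ j := ltn_expl j (isT : 1 < 2).
have cV : #|V| = 2 ^ q by rewrite card_ord.
have ext_cnt := @card_not_has_ext V M E0 j T; rewrite cV in ext_cnt.
have cnt1 : 2 * #|[set g | ~~ has_ext M E0 j g]| < #|{set {set V}}|.
  have /ext_cnt : forall A : {set V}, #|A| = j -> exists S : {set V},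
     [/\ #|S| = 2 ^ j * T, [disjoint S & A] & {in S & A, forall v a, M v a}].
    move=> A cA; have := cardsC A; rewrite cA cV => cC.
    have [|S SA cS] := @subset_of_card _ (~: A) (2 ^ j * T).
      have : 2 ^ j + 2 ^ j * T = 2 ^ q by rewrite qE TE mulnS.
      by move: #|~: A| cC => a; lia.
    by exists S; split => //; rewrite disjoints_subset.
  rewrite -expnS -expnM => cnt.
  have : j * q.+1 + 1 < T by rewrite qE TE mulnC ltn_pmul2l ?expn_gt0 // in jq; lia.
  rewrite mulnC -(ltn_exp2l (m := 2)) // expnD expn1 mulnC => lt.
  have tot : 0 < #|{set {set V}}| by apply/card_gt0P; exists set0.
  move: #|[set g | _]| cnt lt tot => a.
  rewrite (mulnC q.+1); move: #|{set {set V}}| (2 ^ (j * q.+1)) (2 ^ T) => t b c; nia.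
have cnt2 : 2 * #|[set g | contains M E0 F g]| <= #|{set {set V}}|.
  have := @card_contains V M E0 F (fun _ _ _ => isT); rewrite cV -expnM => cnt.
  (* The number [2 ^ (q * #|F|)] of maps is at most half of [2 ^ 'C(#|F|, 2)], because
     [#|F| - 1 >= 2 * q + 1]. *)
  have : 1 + q * #|F| <= 'C(#|F|, 2).
    by rewrite bin2 -[leqLHS]half_double half_leq // -muln2; move: #|F| qF => n; nia.
  rewrite -(leq_exp2l (m := 2)) // expnD expn1 => le.
  move: #|[set g | _]| cnt le => a; have := expn_gt0 2 (q * #|F|).
  move: #|{set {set V}}| (2 ^ (q * #|F|)) (2 ^ 'C(#|F|, 2)) => t b c; nia.
have [g] : exists g, has_ext M E0 j g && ~~ contains M E0 F g.
  apply/existsP; apply: contraTT isT => /existsPn no.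
  suff : #|{set {set V}}| <= #|[set g | ~~ has_ext M E0 j g]| + #|[set g | contains M E0 F g]|.
    by move: cnt1 cnt2; lia.
  apply: leq_trans (leq_card_setU _ _); rewrite -cardsT; apply/subset_leq_card/subsetP=> g _.
  by have := no g; rewrite negb_and negbK !inE.
case/andP=> extg nFg; exists (rand_graph symM symE g).
  by apply: has_ext_extension; rewrite // cV; apply: leq_trans (ltnW j2) _; rewrite leq_exp2l.
case=> f injf adjf; case/negP: nFg; apply/existsP; exists [ffun x => f x].
apply/andP; split; first by apply/injectiveP=> x y; rewrite !ffunE; apply: injf.
by apply/forallP=> x; apply/forallP=> y; rewrite !ffunE; apply/eqP/adjf.
Qed.

Lemma double_sqr_lt_exp2 (u : nat) : 6 < u -> 2 * u ^ 2 < 2 ^ u.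
Proof.
elim: u => // u IHu; rewrite ltnS leq_eqVlt => /orP[/eqP <- //|u6].
by have := IHu u6; rewrite [2 ^ u.+1]expnS -!mulnn; nia.
Qed.

(* The [j.+1] parts are there so that any [j] vertices miss one of them: its
   vertices are joined at random to all of the [j], which gives [extension j],
   while without [F] the graph remains [j.+1]-colourable. *)
Lemma planted_extension_graph (F : sgraph) (j s : nat) :
  exists G : sgraph, [/\ s <= #|G|, extension j G, induced_sub F G &
    #|F| = 0 -> exists col : G -> 'I_j.+1, forall x y, adj x y -> col x != col y].
Proof.
(* [e] makes [2 * #|V| <= 2 ^ (e + u)], and [u] exceeds [e], [j], [s] and 6, so that the failure
   count is governed by [(e + u) * j <= 2 * u ^ 2 < 2 ^ u]. *)
pose e := 2 * (#|F| + j.+1 * 2 ^ j); pose u := e + j + s + 7.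
pose m := 2 ^ j * 2 ^ u; pose V : finType := (F + 'I_j.+1 * 'I_m)%type.
pose M : rel V := fun x y => match x, y with
  | inl _, inl _ => false | inr p, inr q => p.1 != q.1 | _, _ => true end.
pose E0 : rel V := fun x y => if (x, y) is (inl a, inl b) then adj a b else false.
have symM : symmetric M by case=> [a|p] [b|q] //=; rewrite eq_sym.
have symE : symmetric E0 by case=> [a|p] [b|q]; rewrite /E0 //= adj_sym.
have cV : #|V| = #|F| + j.+1 * m by rewrite card_sum card_prod !card_ord.
have mu : u <= m.
  by rewrite (leq_trans (ltnW (ltn_expl u (isT : 1 < 2)))) // leq_pmull // expn_gt0.
have cnt : #|[set g | ~~ has_ext M E0 j g]| < #|{set {set V}}|.
  have tot : 0 < #|{set {set V}}| by apply/card_gt0P; exists set0.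
  have /card_not_has_ext : forall A : {set V}, #|A| = j -> exists S : {set V},
     [/\ #|S| = 2 ^ j * 2 ^ u, [disjoint S & A] & {in S & A, forall v a, M v a}].
    (* Vertices of [F] are assigned part 0 by default; [A] still meets at most [j] of the [j.+1]
       parts. *)
    move=> A cA; pose part (x : V) := if x is inr p then p.1 else ord0.
    have [i iA] : exists i, i \notin part @: A.
      apply/existsP; apply: contraTT isT; rewrite negb_exists => /forallP all_in.
      suff : j.+1 <= #|A| by rewrite cA ltnn.
      rewrite -[j.+1]card_ord; apply: leq_trans (leq_imset_card part A).
      by apply/subset_leq_card/subsetP=> i _; have := all_in i; rewrite negbK.
    have notA x : x \in A -> part x != i.
      by move=> xA; apply: contraNneq iA => <-; apply: imset_f.
    exists [set inr (i, k) | k : 'I_m]; split.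
    - by rewrite card_imset ?card_ord // => k k' [].
    - rewrite disjoint_subset; apply/subsetP=> _ /imsetP[k _ ->].
      by rewrite inE; apply/negP=> /notA; rewrite eqxx.
    - by move=> _ a /imsetP[k _ ->] /notA; case: a => //= p; rewrite eq_sym.
  move=> /(_ E0) cnt.
  rewrite -(ltn_pmul2r (_ : 0 < 2 ^ 2 ^ u)) ?expn_gt0 //.
  apply: leq_ltn_trans cnt _; rewrite mulnC ltn_pmul2l //.
  have le : 2 * #|V| <= 2 ^ (e + u).
    rewrite cV expnD (leq_trans _ (leq_mul (ltnW (ltn_expl e (isT : 1 < 2))) (leqnn _))) //.
    by rewrite /e /m; have := expn_gt0 2 u; nia.
  have {le} : (2 * #|V|) ^ j <= 2 ^ ((e + u) * j).
    by rewrite expnM; case: (posnP j) => [->|j0]; rewrite ?expn0 // leq_exp2r.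
  move/leq_ltn_trans; apply; rewrite ltn_exp2l //.
  apply: leq_ltn_trans (double_sqr_lt_exp2 (_ : 6 < u)); last by rewrite /u; lia.
  by rewrite (leq_trans (leq_mul (_ : e + u <= 2 * u) (_ : j <= u))) // /u; nia.
have [g extg] : exists g, has_ext M E0 j g.
  apply/existsP; apply: contraTT cnt => /existsPn no; rewrite -leqNgt -cardsT.
  by apply/subset_leq_card/subsetP=> g _; rewrite inE no.
have sjV : s + j <= #|V| by rewrite cV; move: mu; rewrite /u; nia.
exists (rand_graph symM symE g); split.
- exact: leq_trans (leq_addr _ _) sjV.
- by apply: has_ext_extension => //; apply: leq_trans (leq_addl _ _) sjV.
- exists inl => [x y [] //|x y]; rewrite /= /rand_adj /=.
  by case: eqVneq => [[->]|] //; rewrite adj_irr.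
move=> F0; have no_F (x : F) : False by have := card0_eq F0 x; rewrite inE.
exists (fun x : V => match x with inl a => False_rect _ (no_F a) | inr p => p.1 end).
case=> [a|p] [b|q]; [by have := no_F a|by have := no_F a|by have := no_F b|].
by rewrite /= /rand_adj /=; case: (p.1 != q.1); rewrite ?andbF.
Qed.

(** * Joins and their connectivity *)

Section Join.
Variables G X : sgraph.

Definition join_adj : rel (G + X)%type := fun x y =>
  match x, y with inl a, inl b => adj a b | inr a, inr b => adj a b | _, _ => true end.

Lemma join_adj_sym : symmetric join_adj.
Proof. by case=> a [] b //=; apply: adj_sym. Qed.

Lemma join_adj_irr : irreflexive join_adj.
Proof. by case=> a /=; apply: adj_irr. Qed.

Definition join := SGraph join_adj_sym join_adj_irr.

End Join.

Lemma induced_sub_joinl (F G X : sgraph) : induced_sub F G -> induced_sub F (join G X).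
Proof.
by case=> f injf adjf; exists (fun x => inl (f x) : join G X) => [x y [] /injf|x y /=].
Qed.

(** Some vertex of [X] survives the deletion of [S] and links the remaining vertices of [G]. Two
    vertices of [X] are adjacent when [X] is complete, and otherwise linked through a surviving
    vertex of [G]. *)
Lemma join_s_connected (s : nat) (G X : sgraph) :
    s < #|X| -> (forall x y : X, x != y -> adj x y) \/ s <= #|G| ->
  s_connected s (join G X).
Proof.
move=> sX GX; split; first by rewrite [#|_|]card_sum ltn_addl.
move=> S cS x y xS yS; set e := [rel u v | _].
have edge (u v : join G X) : u \notin S -> v \notin S -> adj u v -> connect e u v.
  by move=> uS vS uv; apply: connect1; rewrite /= uS vS.
have outside (T : finType) (i : T -> join G X) : injective i -> s <= #|T| ->
    exists z, i z \notin S.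
  move=> inji sT; apply/existsP; apply: contraTT cS => /existsPn all_in.
  rewrite -leqNgt; apply: leq_trans sT _; rewrite -(card_imset _ inji).
  by apply/subset_leq_card/subsetP=> _ /imsetP[z _ ->]; have := all_in z; rewrite negbK.
case: x y xS yS => [a|a] [b|b] aS bS; try exact: edge.
  have [|z zS] := outside X inr _ (ltnW sX); first by move=> ? ? [].
  by apply: (connect_trans (edge _ (inr z) _ _ _) (edge (inr z) _ _ _ _)).
have [->|ab] := eqVneq a b; first exact: connect0.
case: GX => [fullX|sG]; first by apply: edge => //; apply: fullX.
have [|z zS] := outside G inl _ sG; first by move=> ? ? [].
by apply: (connect_trans (edge _ (inl z) _ _ _) (edge (inl z) _ _ _ _)).
Qed.

Section Homogeneous.
Variables (b : bool) (m : nat).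

(** [b] selects the complete graph on [m] vertices or the edgeless one. *)
Lemma homogeneous_sym : symmetric (fun x y : 'I_m => b && (x != y)).
Proof. by move=> x y; rewrite eq_sym. Qed.

Lemma homogeneous_irr : irreflexive (fun x y : 'I_m => b && (x != y)).
Proof. by move=> x; rewrite eqxx andbF. Qed.

Definition homogeneous := SGraph homogeneous_sym homogeneous_irr.

End Homogeneous.

(** * The pebble game on two joins with the same graph *)

Definition upd (T : Type) (v : nat -> option T) (x : nat) (a : T) : nat -> option T :=
  fun z => if z == x then Some a else v z.

Definition same_side (G H X : sgraph) (o : option (join G X)) (o' : option (join H X)) :=
  match o, o' with
  | None, None => true
  | Some (inl _), Some (inl _) => true
  | Some (inr z), Some (inr z') => z == z'
  | _, _ => false
  end.

(** A position that Duplicator has not lost: pebbles in [X] coincide, and those in [G] and [H] form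
    a partial isomorphism. Pairs across the join are adjacent in both graphs. *)
Definition similar (G H X : sgraph) (L : seq nat)
    (v : nat -> option (join G X)) (v' : nat -> option (join H X)) : Prop :=
  {in L, forall x, same_side (v x) (v' x)} /\
  {in L &, forall x y a b a' b',
    v x = Some (inl a) -> v y = Some (inl b) ->
    v' x = Some (inl a') -> v' y = Some (inl b') ->
    (a == b) = (a' == b') /\ adj a b = adj a' b'}.

Lemma similar_sym (G H X : sgraph) L
    (v : nat -> option (join G X)) (v' : nat -> option (join H X)) :
  similar L v v' -> similar L v' v.
Proof.
case=> ss pi; split=> [x /ss|x y xL yL a b a' b' e1 e2 e3 e4].
  by case: (v x) (v' x) => [[a|a]|] [[b|b]|] //=; rewrite eq_sym.
by have [-> ->] := pi x y xL yL _ _ _ _ e3 e4 e1 e2.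
Qed.

Lemma similar_upd (G H X : sgraph) L (v : nat -> option (join G X))
    (v' : nat -> option (join H X)) x (a : join G X) (a' : join H X) :
    similar L v v' -> same_side (Some a) (Some a') ->
    (forall y u c u' c', y \in L -> y != x -> a = inl u -> v y = Some (inl c) ->
       a' = inl u' -> v' y = Some (inl c') ->
       (u == c) = (u' == c') /\ adj u c = adj u' c') ->
  similar L (upd v x a) (upd v' x a').
Proof.
case=> ss pi aa new; split=> [y yL|y z yL zL b c b' c'].
  by rewrite /upd; case: ifP => // _; apply: ss.
rewrite /upd; case: eqVneq => [_|yx]; case: eqVneq => [_|zx].
- by move=> -> [->] -> [->]; rewrite !eqxx !adj_irr.
- by move=> [ea] ez [ea'] ez'; apply: new ea ez ea' ez'.
- move=> ey [ea] ey' [ea']; rewrite eq_sym [b' == _]eq_sym adj_sym [adj b' _]adj_sym.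
  exact: new ea ey ea' ey'.
- exact: pi.
Qed.

(** Lifting the pebble [x] leaves at most [j] others. A move inside [X], or onto a pebbled vertex,
    is copied; any other move is answered by the extension property of [H]. *)
Lemma similar_forth (j : nat) (G H X : sgraph) L (v : nat -> option (join G X))
    (v' : nat -> option (join H X)) x (a : join G X) :
    extension j H -> size L <= j.+1 -> x \in L -> similar L v v' ->
  exists a' : join H X, similar L (upd v x a) (upd v' x a').
Proof.
move=> extH szL xL sim; have [ss pi] := sim.
case: a => [u|z]; last first.
  by exists (inr z); apply: similar_upd => //=.
pose L' := [seq y <- L | y != x].
have szL' : size L' <= j.
  rewrite -ltnS; apply: leq_trans szL; rewrite size_filter -(count_predC (predC1 x) L).
  rewrite -addn1 leq_add2l -has_count; apply/hasP; exists x => //=.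
  by rewrite /= negbK.
have inL' y : y \in L -> y != x -> y \in L' by move=> yL yx; rewrite mem_filter yx.
have [/hasP[y]|] := boolP (has (fun y => v y == Some (inl u)) L').
  rewrite mem_filter => /andP[yx yL] /eqP vy.
  have := ss y yL; rewrite vy /=; case v'y: (v' y) => [[u'|]|] // _.
  exists (inl u'); apply: similar_upd => //= z _ c _ c' zL zx [<-] vz [<-] v'z.
  exact: pi vy vz v'y v'z.
move=> /hasPn new.
(* [A] collects the pebbled vertices of [H], and [B] those whose counterparts are adjacent to
   [u]. *)
pose A := [set b | has (fun y => v' y == Some (inl b)) L'].
pose B := [set b | has (fun y => (v' y == Some (inl b)) &&
  (if v y is Some (inl c) then adj u c else false)) L'].
have [|w wA adjw] := extH A B.
  apply: leq_trans szL'.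
  pose get y := if v' y is Some (inl b) then Some b else None.
  apply: leq_trans (_ : size (pmap get L') <= _); last first.
    by rewrite size_pmap count_size.
  apply: leq_trans (card_size _); apply/subset_leq_card/subsetP=> b.
  rewrite inE => /hasP[y yL' /eqP v'y]; rewrite mem_pmap; apply/mapP; exists y => //.
  by rewrite /get v'y.
exists (inl w); apply: similar_upd => //= y _ c _ c' yL yx [<-] vy [<-] v'y.
have yL' := inL' y yL yx.
have c'A : c' \in A by rewrite inE; apply/hasP; exists y; rewrite ?v'y.
split.
  have -> : (w == c') = false by apply: contraNF wA => /eqP ->.
  by apply: contraNF (new y yL') => /eqP ->; rewrite vy.
rewrite adjw // inE; apply/idP/hasP=> [uc|[z]].
  by exists y => //; rewrite v'y vy eqxx.
rewrite mem_filter => /andP[_ zL] /andP[/eqP v'z]; case vz: (v z) => [[d|]|] //.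
(* Several variables may hold [c']; similarity forces their values in [G] to agree, so [B] is
   consistent. *)
by have [] := pi z y zL yL _ _ _ _ vz vy v'z v'y; rewrite eqxx => /eqP ->.
Qed.

Lemma eval_similar (j : nat) (G H X : sgraph) L :
    extension j G -> extension j H -> size L <= j.+1 ->
  forall phi (v : nat -> option (join G X)) (v' : nat -> option (join H X)),
    {subset vars phi <= L} -> similar L v v' -> eval v phi = eval v' phi.
Proof.
move=> extG extH szL; elim=> [x y|x y|p IHp|p IHp q IHq|x p IHp] v v' /= sL sim.
- have [ss pi] := sim.
  have xL : x \in L by apply: sL; rewrite !inE eqxx.
  have yL : y \in L by apply: sL; rewrite !inE eqxx orbT.
  have := ss x xL; have := ss y yL; have := pi x y xL yL.
  case: (v x) (v' x) => [[a|a]|] [[a'|a']|] //=;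
  case: (v y) (v' y) => [[b|b]|] [[b'|b']|] //=.
    by move=> /(_ _ _ _ _ erefl erefl erefl erefl)[].
  by move=> _ /eqP -> /eqP ->.
- have [ss pi] := sim.
  have xL : x \in L by apply: sL; rewrite !inE eqxx.
  have yL : y \in L by apply: sL; rewrite !inE eqxx orbT.
  have := ss x xL; have := ss y yL; have := pi x y xL yL.
  case: (v x) (v' x) => [[a|a]|] [[a'|a']|] //=;
  case: (v y) (v' y) => [[b|b]|] [[b'|b']|] //=.
    by move=> /(_ _ _ _ _ erefl erefl erefl erefl)[].
  by move=> _ /eqP -> /eqP ->.
- by rewrite (IHp v v').
- rewrite (IHp v v') // ?(IHq v v') // => z zL; apply: sL; rewrite mem_cat zL ?orbT //.
have xL : x \in L by apply: sL; rewrite inE eqxx.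
have sp : {subset vars p <= L} by move=> z zp; apply: sL; rewrite inE zp orbT.
apply/existsP/existsP=> [[a ea]|[a' ea']].
  have [a' sim'] := similar_forth a extH szL xL sim.
  by exists a'; rewrite -(IHp (upd v x a) (upd v' x a')).
have [a sim'] := similar_forth a' extG szL xL (similar_sym sim).
by exists a; rewrite (IHp (upd v x a) (upd v' x a')) //; apply: similar_sym.
Qed.

Lemma holds_join_extension (j : nat) (G H X : sgraph) (phi : formula) :
    extension j G -> extension j H -> num_vars phi <= j.+1 ->
  holds (join G X) phi = holds (join H X) phi.
Proof.
move=> extG extH nv; apply: (eval_similar extG extH nv) => [x|].
  by rewrite mem_undup.
by split.
Qed.

(** * The existential sentence for an induced copy *)

Lemma eval_ext (G : sgraph) phi (v v' : nat -> option G) :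
  v =1 v' -> eval v phi = eval v' phi.
Proof.
elim: phi v v' => [x y|x y|p IHp|p IHp q IHq|x p IHp] v v' e /=; rewrite ?e //.
- by rewrite (IHp v v').
- by rewrite (IHp v v') // (IHq v v').
by apply: eq_existsb => a; apply: IHp => z; rewrite e.
Qed.

Definition exs (xs : seq nat) (p : formula) : formula := foldr FEx p xs.

Lemma eval_exs_intro (G : sgraph) xs p (v u : nat -> option G) :
    (forall x, x \notin xs -> u x = v x) -> {in xs, forall x, u x} ->
  eval u p -> eval v (exs xs p).
Proof.
elim: xs v => [|x xs IHxs] v uv us up /=.
  by rewrite -(eval_ext _ (fun x => uv x isT)).
have := us x (mem_head _ _); case ux: (u x) => [a|] // _.
apply/existsP; exists a; apply: IHxs up => [y yxs|y yxs]; last first.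
  by apply: us; rewrite inE yxs orbT.
by case: eqVneq => [->|yx] //; apply: uv; rewrite inE negb_or yx.
Qed.

Lemma eval_exs_elim (G : sgraph) xs p (v : nat -> option G) :
  eval v (exs xs p) -> exists u : nat -> option G,
    [/\ forall x, x \notin xs -> u x = v x, {in xs, forall x, u x} & eval u p].
Proof.
elim: xs v => [|x xs IHxs] v /=; first by exists v.
case/existsP=> a /IHxs[u [uv us up]]; exists u; split=> // y.
  by rewrite inE negb_or => /andP[/negPf yx /uv]; rewrite yx.
have [yxs _|yxs] := boolP (y \in xs); first exact: us.
by rewrite inE (negPf yxs) orbF uv // => ->.
Qed.

Lemma vars_exs xs p : vars (exs xs p) = xs ++ vars p.
Proof. by elim: xs => //= x xs ->. Qed.

Lemma mem_free_vars_exs xs p y :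
  (y \in free_vars (exs xs p)) = (y \notin xs) && (y \in free_vars p).
Proof.
by elim: xs => //= x xs IHxs; rewrite mem_filter IHxs inE negb_or andbA.
Qed.

Lemma free_vars_sub phi : {subset free_vars phi <= vars phi}.
Proof.
elim: phi => [x y|x y|p IHp|p IHp q IHq|x p IHp] z //=; first exact: IHp.
  by rewrite !mem_cat => /orP[/IHp|/IHq] ->; rewrite ?orbT.
by rewrite mem_filter inE => /andP[_ /IHp] ->; rewrite orbT.
Qed.

Section CopyFormula.
Variable F : sgraph.

Definition pos_if (b : bool) (p : formula) := if b then p else FNot p.

Lemma eval_pos_if (G : sgraph) (v : nat -> option G) b p :
  eval v (pos_if b p) = (eval v p == b).
Proof. by case: b => /=; case: (eval v p). Qed.

(** The rank of a vertex of [F] serves as the variable that stands for it. *)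
Definition pair_diagram (ab : F * F) : formula :=
  let x := enum_rank ab.1 in let y := enum_rank ab.2 in
  FAnd (pos_if (ab.1 == ab.2) (FEq x y)) (pos_if (adj ab.1 ab.2) (FAdj x y)).

(* The innermost conjunct is a tautology; its variable 0 occurs among those
   of the diagram only if [F] is non-empty. *)
Definition diagram : formula :=
  foldr FAnd (FNot (FAnd (FEq 0 0) (FNot (FEq 0 0)))) (map pair_diagram (enum {: F * F})).

Definition copy_formula : formula := exs (iota 0 #|F|) diagram.

Lemma eval_diagram (G : sgraph) (v : nat -> option G) (f : F -> G) :
    (forall a, v (enum_rank a) = Some (f a)) ->
  reflect (forall a b, (f a == f b) = (a == b) /\ adj (f a) (f b) = adj a b)
          (eval v diagram).
Proof.
move=> vf; have -> : eval v diagram = all (fun ab => eval v (pair_diagram ab)) (enum {: F * F}).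
  rewrite /diagram; elim: (enum _) => [|p ps IHps] /=; last by rewrite IHps.
  by rewrite andbN.
have e a b : eval v (pair_diagram (a, b)) =
    ((f a == f b) == (a == b)) && (adj (f a) (f b) == adj a b).
  by rewrite /pair_diagram /= !eval_pos_if /= !vf.
apply: (iffP allP) => [h a b|h [a b] _]; last first.
  by rewrite e; have [-> ->] := h a b; rewrite !eqxx.
by have := h (a, b); rewrite mem_enum e => /(_ isT)/andP[/eqP -> /eqP ->].
Qed.

Lemma holds_copy_formula (G : sgraph) : holds G copy_formula <-> induced_sub F G.
Proof.
split=> [/eval_exs_elim[u [_ us up]]|[f injf adjf]].
  have /fin_all_exists[f uf] (a : F) : exists c, u (enum_rank a) = Some c.
    have := us (enum_rank a); rewrite mem_iota ltn_ord => /(_ isT).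
    by case: (u _) => // c _; exists c.
  have /(eval_diagram uf) fP := up.
  exists f => [a b /eqP|a b]; last by have [] := fP a b.
  by have [-> _] := fP a b => /eqP.
pose u x := omap (fun i : 'I_#|F| => f (enum_val i)) (insub x).
apply: (@eval_exs_intro _ _ _ _ u) => [x|x|].
- by rewrite mem_iota add0n /= => xF; rewrite /u insubN.
- by rewrite mem_iota add0n /= => xF; rewrite /u insubT.
have uf a : u (enum_rank a) = Some (f a) by rewrite /u valK /= enum_rankK.
by apply/(eval_diagram uf) => a b; rewrite (inj_eq injf) adjf.
Qed.

Lemma vars_copy_formula : 0 < #|F| -> {subset vars copy_formula <= iota 0 #|F|}.
Proof.
move=> F0 x; rewrite vars_exs mem_cat => /orP[//|].
rewrite /diagram; elim: (enum _) => [|[a b] ps IHps] /=.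
  by rewrite !inE => /or4P[] /eqP ->; rewrite mem_iota.
rewrite mem_cat => /orP[|/IHps //].
by rewrite mem_cat /pos_if; do 2 case: ifP => _;
  rewrite /= !inE => /orP[] /orP[] /eqP ->; rewrite mem_iota /=.
Qed.

Lemma sentence_copy_formula : 0 < #|F| -> sentence copy_formula.
Proof.
move=> F0; rewrite /sentence /nilp; case e: (free_vars _) => [|x xs] //.
have : x \in free_vars copy_formula by rewrite e mem_head.
rewrite mem_free_vars_exs => /andP[/negP nx xd]; case: nx.
apply: (vars_copy_formula F0); rewrite vars_exs mem_cat.
by rewrite (free_vars_sub xd) orbT.
Qed.

Lemma num_vars_copy_formula : 0 < #|F| -> num_vars copy_formula <= #|F|.
Proof.
move=> F0; rewrite /num_vars -[leqRHS](size_iota 0); apply: uniq_leq_size.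
  exact: undup_uniq.
by move=> x; rewrite mem_undup; apply: vars_copy_formula.
Qed.

End CopyFormula.

(** * Universal vertices and copies inside a join *)

Section InducedOn.
Variables (F : sgraph) (U : {set F}).

Lemma induced_on_sym : symmetric (fun x y : {x | x \in U} => adj (val x) (val y)).
Proof. by move=> x y; apply: adj_sym. Qed.

Lemma induced_on_irr : irreflexive (fun x y : {x | x \in U} => adj (val x) (val y)).
Proof. by move=> x; apply: adj_irr. Qed.

Definition induced_on := SGraph induced_on_sym induced_on_irr.

Lemma card_induced_on : #|induced_on| = #|U|.
Proof. exact: card_sig. Qed.

End InducedOn.

Definition universal (F : sgraph) : {set F} :=
  [set x | [forall y, (x != y) ==> adj x y]].

(** Universal vertices are pairwise adjacent: their images in [H] have distinct colours and at most
    one lies in the edgeless [X], whose colour is [None]. *)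
Lemma universal_card_join (F H X : sgraph) (k : nat) (col : H -> 'I_k) :
    (forall x y, adj x y -> col x != col y) -> (forall x y : X, ~~ adj x y) ->
  induced_sub F (join H X) -> #|universal F| <= k.+1.
Proof.
move=> colP indX [f injf adjf].
pose c x := if f x is inl a then Some (col a) else None.
rewrite -[k in k.+1]card_ord -card_option -(@card_in_imset _ _ c) ?max_card //.
move=> x y; rewrite inE => /forallP/(_ y) + _; case: eqVneq => //= _.
rewrite -adjf /c; case: (f x) (f y) => [a|a] [b|b] //=; last by rewrite (negPf (indX _ _)).
by move=> /colP ab [/eqP]; rewrite (negPf ab).
Qed.

(** When [X] is a clique, each of its vertices is adjacent to every other vertex of the join, so a
    vertex of [F] with a non-neighbour cannot be mapped into [X]. *)
Lemma nonuniversal_in_join (F H X : sgraph) :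
    (forall x y : X, x != y -> adj x y) ->
  induced_sub F (join H X) -> induced_sub (induced_on (~: universal F)) H.
Proof.
move=> fullX [f injf adjf].
have /fin_all_exists[h hP] (x : induced_on (~: universal F)) :
    exists a, f (val x) = inl a.
  have := valP x; rewrite !inE => /forallPn[y]; rewrite negb_imply => /andP[xy].
  rewrite -adjf; case e: (f (val x)) => [a|a]; first by exists a.
  case e': (f y) => [b|b] //=; rewrite fullX //.
  by apply: contra_neq xy => ab; apply: injf; rewrite e e' ab.
exists h => [x y hxy|x y]; first by apply/val_inj/injf; rewrite !hP hxy.
by rewrite [RHS]/= -adjf !hP.
Qed.

(* With [2 ^ q] vertices, [q = (l - j - 4)./2], a random graph avoids a pattern
   on [l - j - 2] vertices and still has [extension j]. *)
Lemma exponent_arith (l j : nat) : 1 < l -> l ^ 4 * 8 ^ j <= 2 ^ l ->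
  j + 4 <= l /\ (j * ((l - j - 4)./2).+1 + 2) * 2 ^ j < 2 ^ ((l - j - 4)./2).
Proof.
move=> l1 le.
(* The powers [l ^ 4] and [2 ^ l] meet at 16, and [l ^ 4] is larger for [l] from 2 to 15. *)
have l15 : 15 < l.
  rewrite ltnNge; apply/negP=> l15.
  have : l ^ 4 <= 2 ^ l by apply: leq_trans le; rewrite leq_pmulr // expn_gt0.
  by move: l l1 l15 {le}; do 16 (case=> [|]; first by lia); lia.
have jl : 3 * j + 4 <= l.
  rewrite -(leq_exp2l (m := 2)) // expnD expnM; apply: leq_trans le.
  rewrite mulnC leq_mul2r; apply/orP; right.
  by apply: (@leq_trans (2 ^ 4)) => //; rewrite leq_exp2r // ltnW.
split; first by lia.
set q := (_)./2; have qE : l <= 2 * q + j + 5.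
  by rewrite /q; have := odd_double_half (l - j - 4); lia.
have qU : 2 * q + j + 4 <= l by rewrite /q; have := odd_double_half (l - j - 4); lia.
(* Squaring the goal avoids the rounding in [q]: the hypothesis divided by [2 ^ j] bounds [4 ^ q]
   from below through [l - j <= 2 * q + 5]. *)
have sq : l ^ 4 * (2 ^ j) ^ 2 <= 32 * (2 ^ q) ^ 2.
  rewrite -(leq_pmul2r (_ : 0 < 2 ^ j)) ?expn_gt0 //.
  apply: (@leq_trans (2 ^ l)).
    by apply: leq_trans le; rewrite -mulnA -expnSr -!expnM -(expnM 2 3) (mulnC j).
  rewrite -(expnM 2 q 2) -[32]/(2 ^ 5) -!expnD leq_exp2l //; lia.
have small : 32 * (j * q.+1 + 2) ^ 2 < l ^ 4.
  (* Here [2 * q.+1 <= l - j], and [4 * j * (l - j) <= l ^ 2] by the inequality of arithmetic and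
     geometric means. *)
  have le1 : 8 * (j * q.+1) <= l ^ 2.
    apply: (@leq_trans (4 * (j * (l - j)))); last by rewrite -mulnn; nia.
    by nia.
  have l2 : 256 <= l ^ 2 by rewrite -mulnn; nia.
  rewrite (expnM l 2 2 : l ^ 4 = _).
  move: (j * q.+1) (l ^ 2) le1 l2 => a b ab b256.
  have : (8 * (a + 2)) ^ 2 <= (b + 16) ^ 2 by rewrite leq_sqr; lia.
  have : (b + 16) ^ 2 < 2 * b ^ 2 by rewrite -!mulnn; nia.
  by rewrite expnMn; move: ((a + 2) ^ 2) ((b + 16) ^ 2) (b ^ 2); lia.
rewrite -(ltn_exp2r _ _ (isT : 0 < 2)) expnMn.
rewrite -(ltn_pmul2l (_ : 0 < 32)) //; apply: leq_trans sq.
by rewrite mulnA ltn_pmul2r // !expn_gt0.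
Qed.

(** * Indistinguishable pairs and the lower bound *)

Lemma indistinguishable_pair (F : sgraph) (j s : nat) :
    1 < #|F| -> #|F| ^ 4 * 8 ^ j <= 2 ^ #|F| ->
  exists G H : sgraph, [/\ induced_sub F G, ~ induced_sub F H,
    s_connected s G, s_connected s H &
    forall phi, num_vars phi <= j.+1 -> holds G phi = holds H phi].
Proof.
move=> F1 le; have [jF arith] := exponent_arith F1 le.
have [G [sG extG FG _]] := planted_extension_graph F j s.
have [many|few] := ltnP j.+2 #|universal F|.
  (* Planting the empty graph gives the purely [j.+1]-partite random graph. *)
  have [H [sH extH _ colH]] := planted_extension_graph (homogeneous false 0) j s.
  have [col colP] := colH (card_ord 0).
  pose X := homogeneous false s.+1.
  have cX : s < #|X| by rewrite card_ord.
  have indX (x y : X) : ~~ adj x y by [].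
  exists (join G X), (join H X); split.
  - exact: induced_sub_joinl.
  - by move/(universal_card_join colP indX); rewrite leqNgt many.
  - by apply: join_s_connected => //; right.
  - by apply: join_s_connected => //; right.
  - by move=> phi; apply: holds_join_extension.
have [|H extH FH] := free_extension_graph (F := induced_on (~: universal F)) _ arith.
  (* At least [#|F| - j - 2] vertices are non-universal, which is at least [2 * q + 2] for the
     chosen [q]. *)
  rewrite card_induced_on; have := cardsC (universal F).
  by have := odd_double_half (#|F| - j - 4); lia.
pose X := homogeneous true s.+1.
have cX : s < #|X| by rewrite card_ord.
have fullX (x y : X) : x != y -> adj x y by [].
exists (join G X), (join H X); split.
- exact: induced_sub_joinl.
- by move/(nonuniversal_in_join fullX).
- by apply: join_s_connected => //; left.
- by apply: join_s_connected => //; left.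
- by move=> phi; apply: holds_join_extension.
Qed.

Lemma nat_minP (A : set nat) (n : nat) : A n -> A (nat_min A) /\ nat_min A <= n.
Proof.
move=> An; have [m [Am minm]] : exists m, A m /\ forall k, A k -> m <= k.
  pose P k := `[< A k >]; have exP : exists k, P k by exists n; apply/asboolP.
  case: (ex_minnP exP) => m /asboolP Am minm; exists m; split=> // k Ak.
  by apply: minm; apply/asboolP.
rewrite /nat_min; case: xgetP => [k -> [Ak mink]|/(_ m)[]]; last by split.
by split=> //; apply: mink.
Qed.

Lemma nat_maxP (A : set nat) (n b : nat) :
  A n -> (forall m, A m -> m <= b) -> n <= nat_max A.
Proof.
move=> An leb; have [m [Am maxm]] : exists m, A m /\ forall k, A k -> k <= m.
  pose P k := `[< A k >]; have exP : exists k, P k by exists n; apply/asboolP.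
  have leP k : P k -> k <= b by move/asboolP; apply: leb.
  case: (ex_maxnP exP leP) => m /asboolP Am maxm; exists m; split=> // k Ak.
  by apply: maxm; apply/asboolP.
rewrite /nat_max; case: xgetP => [k -> [Ak maxk]|/(_ m)[]]; last by split.
exact: maxk.
Qed.

(** [copy_formula F] separates [G] from [H], so the minimum in [W] is attained rather than
    defaulting to 0. *)
Lemma W_spec (F G H : sgraph) :
    0 < #|F| -> induced_sub F G -> ~ induced_sub F H ->
  W G H <= #|F| /\ exists phi, [/\ sentence phi, holds G phi != holds H phi & num_vars phi = W G H].
Proof.
move=> F0 FG FH; have [|WA Wle] := @nat_minP [set k | exists phi : formula,
    [/\ sentence phi, holds G phi != holds H phi & num_vars phi = k]]%classic
    (num_vars (copy_formula F)).
  exists (copy_formula F); split=> //; first exact: sentence_copy_formula.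
  have -> : holds G (copy_formula F) by apply/holds_copy_formula.
  by case e: (holds H _) => //; case: FH; apply/holds_copy_formula.
by split; first exact: leq_trans Wle (num_vars_copy_formula F0).
Qed.

(** The minimum over connectivities is attained at some [s], and the pair built for this [s] has [W]
    above [j]. The bound [#|F|] on all values makes [nat_max] a true maximum. *)
Lemma Wkappa_lower_bound (F : sgraph) (j : nat) :
  1 < #|F| -> #|F| ^ 4 * 8 ^ j <= 2 ^ #|F| -> j < Wkappa F.
Proof.
move=> F1 le.
have [|[s _ sE] _] := @nat_minP (range (Wkappa_at F)) (Wkappa_at F 0); first by exists 0.
rewrite /Wkappa -sE.
have [G [H [FG FH sG sH GH]]] := indistinguishable_pair s F1 le.
have F0 := ltnW F1.
have jW : j < W G H.
  have [_ [phi [_ neq <-]]] := W_spec F0 FG FH.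
  by rewrite ltnNge; apply: contra neq => nv; rewrite GH // ltnW.
apply: leq_trans jW _; rewrite /Wkappa_at.
apply: (@nat_maxP _ _ #|F|); first by exists G, H.
by move=> _ [G' [H' [FG' FH' _ _ <-]]]; have [] := W_spec F0 FG' FH'.
Qed.

Local Open Scope ring_scope.
Import Order.TTheory GRing.Theory Num.Theory.

Theorem theorem5p5 (R : realType) (F : sgraph) (l : nat)
  (hF : #|F| = l) (hl : (1 < l)%N) :
  1 / 3 * l%:R - 4 / 3 * log2 (l%:R : R) < (Wkappa F)%:R.
Proof.
(* Otherwise the lower bound with [j = Wkappa F] would give [Wkappa F < Wkappa F]. Taking logarithms
   then yields the claim. *)
have key : (2 ^ l < l ^ 4 * 8 ^ Wkappa F)%N.
  rewrite ltnNge; apply/negP=> le; rewrite -hF in hl le.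
  by have := Wkappa_lower_bound hl le; rewrite ltnn.
have l0 : 0 < l%:R :> R by rewrite ltr0n ltnW.
have ln2 : 0 < ln 2 :> R by apply: ln_gt0; rewrite ltr1n.
have : ln (2 ^+ l : R) < ln (l%:R ^+ 4 * 8 ^+ Wkappa F).
  by rewrite ltr_ln ?posrE ?mulr_gt0 ?exprn_gt0 // -!natrX -natrM ltr_nat.
rewrite lnM ?posrE ?exprn_gt0 // !lnXn // (_ : 8 = 2 ^+ 3 :> R) ?lnXn //; last first.
  by rewrite -natrX.
have lnl : ln l%:R = log2 (l%:R : R) * ln 2 by rewrite /log2 divfK // gt_eqF.
rewrite lnl -[ln 2 *+ l]mulr_natr -[_ *+ Wkappa F]mulr_natr.
move: (log2 _) (ln 2) ln2 => L t t0 lt.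
suff : l%:R < 4 * L + 3 * (Wkappa F)%:R by lra.
by rewrite -(ltr_pM2r t0); lra.
Qed.
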